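(* Let $A$ be the free algebra in one variable $x$ of a variety of symmetric $m$-ary algebras over a field $k$ of characteristic $0$. Then $\mathscr{L}(A)_+$ is generated, as an algebra, by $D=\langle x,x,\ldots,x\rangle\partial_x$.
   Context: Let $m\ge 2$. An $m$-ary algebra over $k$ is a $k$-vector space with one $m$-ary multilinear operation $\langle\cdot,\ldots,\cdot\rangle$; it is symmetric if $\langle a_1,\ldots,a_m\rangle=\langle a_{\sigma(1)},\ldots,a_{\sigma(m)}\rangle$ for all elements $a_1,\ldots,a_m$ and all permutations $\sigma\in S_m$. A derivation is a $k$-linear map satisfying the Leibniz rule for the operation. If $m=2$ and the variety is a unitary variety (a variety of algebras with identity element), $A$ is assumed to contain an identity element. Varieties are assumed nontrivial. For $a\in A$, $a\partial_x$ denotes the unique derivation of $A$ with $x\mapsto a$; every derivation of $A$ has this form. $\mathscr{L}(A)$ denotes the space $\mathrm{Der}_kA$ of all $k$-linear derivations of $A$ with the product $(a\partial_x)\cdot(b\partial_x)=((a\partial_x)(b))\partial_x$ for $a,b\in A$. Let $A=A_0\oplus A_1\oplus A_2\oplus\cdots$ be the grading of $A$ by degree in $x$ ($A_i$ is the space of homogeneous elements of degree $i$). Then $\mathscr{L}(A)=L_{-1}\oplus L_0\oplus L_1\oplus\cdots$, where $L_i=\{a\partial_x: a\in A_{i+1}\}$. The positive part of $\mathscr{L}(A)$ is the subalgebra $\mathscr{L}(A)_+=L_1\oplus L_2\oplus\cdots$. *)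

(* Defs.v *)
From HB Require Import structures.
From mathcomp Require Import all_boot all_order all_fingroup all_algebra.
From mathcomp Require Import boolp classical_sets.

Set Implicit Arguments.
Unset Strict Implicit.
Unset Printing Implicit Defensive.

Import GRing.Theory.
Local Open Scope ring_scope.
Local Open Scope classical_set_scope.

Definition upd (m : nat) (T : Type) (a : {ffun 'I_m -> T}) (i : 'I_m) (t : T) :
  {ffun 'I_m -> T} := [ffun j => if j == i then t else a j].

(* The boolean u says whether the signature has, besides the m-ary operation,
   a constant interpreted as an identity element. It is [true] only for
   unitary varieties, where m = 2 and [mop_one] reads a * 1 = 1 * a = a. *)
Record malg (k : fieldType) (m : nat) (u : bool) := MAlg {
  malg_sort :> lmodType k;
  mop : {ffun 'I_m -> malg_sort} -> malg_sort;
  mone : u -> malg_sort;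
  mop_multilinear : forall (a : {ffun 'I_m -> malg_sort}) (i : 'I_m) (c : k)
    (b b' : malg_sort),
    mop (upd a i (c *: b + b')) = c *: mop (upd a i b) + mop (upd a i b');
  mop_one : forall (hu : u) (i : 'I_m) (a : malg_sort),
    mop (upd [ffun=> mone hu] i a) = a } as A.
Arguments mone {k m u} A hu.

Definition symmetric_malg (k : fieldType) (m : nat) (u : bool)
    (A : malg k m u) : Prop :=
  forall (a : {ffun 'I_m -> A}) (s : 'S_m), mop [ffun i => a (s i)] = mop a.

Definition malg_hom (k : fieldType) (m : nat) (u : bool) (A B : malg k m u)
    (f : A -> B) : Prop :=
  [/\ forall (c : k) (a b : A), f (c *: a + b) = c *: f a + f b,
      forall a : {ffun 'I_m -> A}, f (mop a) = mop [ffun i => f (a i)]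
    & forall hu : u, f (mone A hu) = mone B hu].

(* Nonassociative polynomials in the variables X_0, X_1, ... *)
Inductive mterm (k : fieldType) (m : nat) (u : bool) : Type :=
| TVar of nat
| TZero
| TAdd of mterm k m u & mterm k m u
| TScale of k & mterm k m u
| TOp of ('I_m -> mterm k m u)
| TOne of u.

Fixpoint teval (k : fieldType) (m : nat) (u : bool) (A : malg k m u)
    (v : nat -> A) (t : mterm k m u) : A :=
  match t with
  | TVar n => v n
  | TZero => 0
  | TAdd s t => teval v s + teval v t
  | TScale c t => c *: teval v t
  | TOp f => mop [ffun i => teval v (f i)]
  | TOne hu => mone A hu
  end.

(* The variety defined by the identities f = 0, f in E. *)
Definition variety (k : fieldType) (m : nat) (u : bool)
    (E : set (mterm k m u)) (A : malg k m u) : Prop :=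
  forall f, E f -> forall v : nat -> A, teval v f = 0.

Definition nontrivial_variety (k : fieldType) (m : nat) (u : bool)
    (E : set (mterm k m u)) : Prop :=
  exists2 A : malg k m u, variety E A & exists a : A, a <> 0.

Definition free_on (k : fieldType) (m : nat) (u : bool)
    (E : set (mterm k m u)) (A : malg k m u) (x : A) : Prop :=
  variety E A /\
  forall B : malg k m u, variety E B -> forall b : B,
    exists f : A -> B, [/\ malg_hom f, f x = b &
      forall g : A -> B, malg_hom g -> g x = b -> g =1 f].

Definition is_derivation (k : fieldType) (m : nat) (u : bool)
    (A : malg k m u) (d : A -> A) : Prop :=
  (forall (c : k) (a b : A), d (c *: a + b) = c *: d a + d b) /\
  (forall a : {ffun 'I_m -> A},
     d (mop a) = \sum_(i < m) mop (upd a i (d (a i)))).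

Record der (k : fieldType) (m : nat) (u : bool) (A : malg k m u) := Der {
  der_fun :> A -> A;
  derP : is_derivation der_fun }.

Section DerLmodule.
Variables (k : fieldType) (m : nat) (u : bool) (A : malg k m u).
Implicit Types d e : der A.

Lemma der_ext d e : d =1 e -> d = e.
Proof.
case: d e => [d dP] [e eP] /= /funext de.
by case: e / de eP => eP; rewrite (Prop_irrelevance dP eP).
Qed.

Lemma mop_updD (a : {ffun 'I_m -> A}) i b b' :
  mop (upd a i (b + b')) = mop (upd a i b) + mop (upd a i b').
Proof. by rewrite -[b in LHS]scale1r mop_multilinear scale1r. Qed.

Lemma mop_upd0 (a : {ffun 'I_m -> A}) i : mop (upd a i 0) = 0.
Proof. by apply: (@addrI _ (mop (upd a i 0))); rewrite -mop_updD !addr0. Qed.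

Lemma mop_updZ (a : {ffun 'I_m -> A}) i c b :
  mop (upd a i (c *: b)) = c *: mop (upd a i b).
Proof. by rewrite -[c *: b]addr0 mop_multilinear mop_upd0 addr0. Qed.

Fact der0_subproof : is_derivation (fun _ : A => 0).
Proof.
by split=> [c a b|a]; rewrite ?scaler0 ?addr0 // big1 // => i _; rewrite mop_upd0.
Qed.

Fact derD_subproof d e : is_derivation (fun a => d a + e a).
Proof.
case: (derP d) (derP e) => dl dm [el em]; split=> [c a b|a].
  by rewrite dl el scalerDr addrACA.
by rewrite dm em -big_split; apply: eq_bigr => i _; rewrite mop_updD.
Qed.

Fact derZ_subproof c d : is_derivation (fun a => c *: d a).
Proof.
case: (derP d) => dl dm; split=> [c' a b|a].
  by rewrite dl scalerDr !scalerA mulrC.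
by rewrite dm scaler_sumr; apply: eq_bigr => i _; rewrite mop_updZ.
Qed.

Definition der0 : der A := Der der0_subproof.
Definition derD d e : der A := Der (derD_subproof d e).
Definition derZ c d : der A := Der (derZ_subproof c d).

HB.instance Definition _ := gen_eqMixin (der A).
HB.instance Definition _ := gen_choiceMixin (der A).

Fact derDA : associative derD.
Proof. by move=> d e f; apply: der_ext => a /=; rewrite addrA. Qed.
Fact derDC : commutative derD.
Proof. by move=> d e; apply: der_ext => a /=; rewrite addrC. Qed.
Fact der0D : left_id der0 derD.
Proof. by move=> d; apply: der_ext => a /=; rewrite add0r. Qed.
Fact derND : left_inverse der0 (derZ (-1)) derD.
Proof. by move=> d; apply: der_ext => a /=; rewrite scaleN1r addNr. Qed.

HB.instance Definition _ :=
  GRing.isZmodule.Build (der A) derDA derDC der0D derND.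

Fact derZA a b d : derZ a (derZ b d) = derZ (a * b) d.
Proof. by apply: der_ext => z /=; rewrite scalerA. Qed.
Fact derZ1 : left_id 1 derZ.
Proof. by move=> d; apply: der_ext => z /=; rewrite scale1r. Qed.
Fact derZDr : right_distributive derZ +%R.
Proof. by move=> c d e; apply: der_ext => z /=; rewrite scalerDr. Qed.
Fact derZDl d : {morph derZ^~ d : a b / a + b}.
Proof. by move=> a b; apply: der_ext => z /=; rewrite scalerDl. Qed.

HB.instance Definition _ :=
  GRing.Zmodule_isLmodule.Build k (der A) derZA derZ1 derZDr derZDl.

End DerLmodule.

(* The derivation a ∂_x. When A is free on x in a variety over a field of
   characteristic 0 there is exactly one derivation mapping x to a; the default
   value 0 is then never used. *)
Definition partial (k : fieldType) (m : nat) (u : bool) (A : malg k m u)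
    (x a : A) : der A := xget 0 [set d : der A | d x = a].

(* The product of the algebra L(A), whose underlying space is [der A]:
   since d = (d x) ∂_x, d . e is the derivation (d (e x)) ∂_x. *)
Definition der_mul (k : fieldType) (m : nat) (u : bool) (A : malg k m u)
    (x : A) (d e : der A) : der A := partial x (d (e x)).

Definition der_subalgebra (k : fieldType) (m : nat) (u : bool)
    (A : malg k m u) (x : A) (S : set (der A)) : Prop :=
  [/\ S 0, forall (c : k) (d e : der A), S d -> S e -> S (c *: d + e)
    & forall d e : der A, S d -> S e -> S (der_mul x d e)].

(* [homog x n] is the component A_n: the span of the monomials of degree n
   in x. *)
Inductive homog (k : fieldType) (m : nat) (u : bool) (A : malg k m u)
    (x : A) : nat -> A -> Prop :=
| homog_one (hu : u) : homog x 0 (mone A hu)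
| homog_var : homog x 1 x
| homog_op (n : 'I_m -> nat) (a : {ffun 'I_m -> A}) :
    (forall i, homog x (n i) (a i)) -> homog x (\sum_(i < m) n i)%N (mop a)
| homog_zero (n : nat) : homog x n 0
| homog_lin (n : nat) (c : k) (a b : A) :
    homog x n a -> homog x n b -> homog x n (c *: a + b).

(* L_i for i >= 0; the component L_{-1} is not needed. *)
Definition der_homog (k : fieldType) (m : nat) (u : bool) (A : malg k m u)
    (x : A) (i : nat) : set (der A) :=
  [set partial x a | a in [set a | homog x i.+1 a]].

Definition der_pos (k : fieldType) (m : nat) (u : bool) (A : malg k m u)
    (x : A) : set (der A) :=
  [set d | exists (n : nat) (e : 'I_n -> der A),
     (forall i : 'I_n, der_homog x i.+1 (e i)) /\ d = \sum_(i < n) e i].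

(* Main.v *)
(** The derivation [a ∂_x] is built by evaluating the homomorphism
    [x |-> x + t a] from [A] to the functions of [t], a product of copies of
    [A], hence a member of the variety. Its values are polynomial in [t], and
    in characteristic 0 the coefficient of [t] is well defined: it is the value
    of the derivation. Derivations are determined by their value at [x] because
    [A] has no proper subalgebra containing [x].

    Let [S] be a subalgebra of [L(A)] containing [D], and [G] the set of the [a]
    with [a ∂_x] in [S], so that [G] is stable under [a ∂_x] for [a] in [G].
    Every product of elements of [G] and copies of [x] lies in [G], by induction
    on the number r of factors from [G]: applying [a_r ∂_x] to
    [<a_1, .., a_(r-1), x, .., x>] gives [(m - r + 1) <a_1, .., a_r, x, .., x>]
    by symmetry, plus products with r - 1 factors from [G]. Hence [G] contains
    all homogeneous elements of degree at least 2. *)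

Require Import Defs.
From mathcomp Require Import all_boot all_order all_fingroup all_algebra.
From mathcomp Require Import boolp classical_sets functions.
From HB Require Import structures.

Set Implicit Arguments.
Unset Strict Implicit.
Unset Printing Implicit Defensive.

Import GRing.Theory.
Local Open Scope ring_scope.
Local Open Scope classical_set_scope.

(** * Linear maps at zero and updates of one slot of a family *)

Lemma lin_fun0 (k : fieldType) (V W : lmodType k) (d : V -> W) :
  (forall (c : k) (a b : V), d (c *: a + b) = c *: d a + d b) -> d 0 = 0.
Proof.
by move=> dl; rewrite -[0 in LHS](addNr 0) -scaleN1r dl scaleN1r addNr.
Qed.

Section Upd.
Variables (m : nat) (T : Type).
Implicit Types (a : {ffun 'I_m -> T}) (i j : 'I_m).

Lemma upd_eq a i t : upd a i t i = t.
Proof. by rewrite ffunE eqxx. Qed.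

Lemma upd_neq a i j t : j != i -> upd a i t j = a j.
Proof. by rewrite ffunE => /negPf ->. Qed.

Lemma upd_upd a i t t' : upd (upd a i t) i t' = upd a i t'.
Proof. by apply/ffunP => j; rewrite !ffunE; case: eqP. Qed.

Lemma upd_id a i : upd a i (a i) = a.
Proof. by apply/ffunP => j; rewrite !ffunE; case: eqP => // ->. Qed.

Lemma updC a i j t t' :
  i != j -> upd (upd a i t) j t' = upd (upd a j t') i t.
Proof.
move=> ij; apply/ffunP => l; rewrite !ffunE.
by case: (eqVneq l j) => // ->; rewrite eq_sym (negPf ij).
Qed.

Lemma map_upd (T' : Type) (f : T -> T') a i t :
  [ffun j => f (upd a i t j)] = upd [ffun j => f (a j)] i (f t).
Proof. by apply/ffunP => j; rewrite !ffunE; case: ifP. Qed.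

End Upd.

(** * Subalgebras as algebras in their own right *)

Section Subalgebra.
Variables (k : fieldType) (m : nat) (u : bool) (A : malg k m u).

(** Bundling a property with its closure conditions lets it serve as the motive of the induction
    principle [free_ind]. *)
Record subalgebra := Subalgebra {
  subalg_pred :> A -> Prop;
  subalg0 : subalg_pred 0;
  subalg_lin : forall (c : k) a b,
    subalg_pred a -> subalg_pred b -> subalg_pred (c *: a + b);
  subalg_op : forall a : {ffun 'I_m -> A},
    (forall i, subalg_pred (a i)) -> subalg_pred (mop a);
  subalg_one : forall hu : u, subalg_pred (mone A hu) }.

Variable S : subalgebra.

Definition subalg_mem : pred A := fun a => `[< S a >].

Fact subalg_mem_closed : subsemimod_closed subalg_mem.
Proof.
have Z c a : a \in subalg_mem -> c *: a \in subalg_mem.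
  move=> /asboolP Sa; apply/asboolP; rewrite -[c *: a]addr0.
  by apply: subalg_lin => //; apply: subalg0.
split; last by move=> c a; apply: Z.
split=> [|a b /asboolP Sa /asboolP Sb]; first exact/asboolP/subalg0.
by apply/asboolP; rewrite -[a]scale1r; apply: subalg_lin.
Qed.

HB.instance Definition _ :=
  GRing.isSubmodClosed.Build k A subalg_mem subalg_mem_closed.

Definition subalg_sort : Type := {a : A | subalg_mem a}.

HB.instance Definition _ := SubChoice.on subalg_sort.
HB.instance Definition _ := [SubChoice_isSubLmodule of subalg_sort by <:].

Lemma subalg_valP (c : k) (a b : subalg_sort) :
  val (c *: a + b) = c *: val a + val b.
Proof. exact: (linearP (\val : subalg_sort -> A)). Qed.

Lemma subalgP (a : subalg_sort) : S (val a).
Proof. exact/asboolP/(valP a). Qed.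

Definition to_subalg a (Sa : S a) : subalg_sort := Sub a (asboolT Sa).

Lemma to_subalgK a (Sa : S a) : val (to_subalg Sa) = a.
Proof. exact: SubK. Qed.

Fact subalg_mop_subproof (a : {ffun 'I_m -> subalg_sort}) :
  S (mop [ffun i => val (a i)]).
Proof. by apply: subalg_op => i; rewrite ffunE; apply: subalgP. Qed.

Definition subalg_mop (a : {ffun 'I_m -> subalg_sort}) : subalg_sort :=
  to_subalg (subalg_mop_subproof a).

Fact subalg_mop_multilinear (a : {ffun 'I_m -> subalg_sort}) i (c : k) b b' :
  subalg_mop (upd a i (c *: b + b')) =
    c *: subalg_mop (upd a i b) + subalg_mop (upd a i b').
Proof.
apply: val_inj; rewrite subalg_valP !to_subalgK !map_upd subalg_valP.
exact: mop_multilinear.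
Qed.

Fact subalg_mop_one (hu : u) (i : 'I_m) (a : subalg_sort) :
  subalg_mop (upd [ffun=> to_subalg (subalg_one S hu)] i a) = a.
Proof.
apply: val_inj; rewrite to_subalgK map_upd.
rewrite (_ : [ffun _ => _] = [ffun=> mone A hu]); first exact: mop_one.
by apply/ffunP => j; rewrite !ffunE.
Qed.

Definition subalg : malg k m u := MAlg subalg_mop_multilinear subalg_mop_one.

Lemma subalg_val_hom : malg_hom (val : subalg -> A).
Proof. by split=> // c a b; apply: subalg_valP. Qed.

End Subalgebra.

(** * Homomorphisms, free algebras and algebras of functions *)

Section Homomorphisms.
Variables (k : fieldType) (m : nat) (u : bool).
Implicit Types A B C : malg k m u.

Lemma hom0 A B (f : A -> B) : malg_hom f -> f 0 = 0.
Proof. by case=> /lin_fun0. Qed.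

Lemma hom_comp A B C (f : A -> B) (g : B -> C) :
  malg_hom f -> malg_hom g -> malg_hom (g \o f).
Proof.
move=> [fl fm f1] [gl gm g1]; split=> [c a b|a|h] /=.
- by rewrite fl gl.
- by rewrite fm gm; congr mop; apply/ffunP => i; rewrite !ffunE.
- by rewrite f1 g1.
Qed.

Lemma hom_teval A B (f : A -> B) (v : nat -> A) (t : mterm k m u) :
  malg_hom f -> f (teval v t) = teval (f \o v) t.
Proof.
move=> fh; have f0 := hom0 fh; case: fh => fl fm f1.
elim: t => [n||s IHs t IHt|c t IHt|ts IHt|hu] //=.
- by rewrite -IHs -IHt -[teval v s in LHS]scale1r fl scale1r.
- by rewrite -[c *: teval v t]addr0 fl f0 addr0 IHt.
- by rewrite fm; congr mop; apply/ffunP => i; rewrite !ffunE IHt.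
Qed.

Lemma variety_subalg (E : set (mterm k m u)) A (S : subalgebra A) :
  variety E A -> variety E (subalg S).
Proof.
move=> EA f Ef v; apply: val_inj.
by rewrite (hom_teval _ _ (@subalg_val_hom _ _ _ _ S)) EA // linear0.
Qed.

(** Uniqueness in the universal property with target [A]: [f] and the identity agree at [x]. *)
Lemma free_hom_id (E : set (mterm k m u)) A x (f : A -> A) :
  free_on E x -> malg_hom f -> f x = x -> f =1 id.
Proof.
move=> [EA /(_ A EA x)[g [_ _ gu]]] fh fx a; rewrite (gu _ fh fx).
rewrite -(gu id) //; split=> // b; congr mop; apply/ffunP => i.
by rewrite ffunE.
Qed.

(** The universal property gives a homomorphism from [A] to [S] fixing [x]. Followed by the
    inclusion it is an endomorphism of [A] fixing [x], hence the identity, so every element lies in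
    [S]. *)
Lemma free_ind (E : set (mterm k m u)) A x (S : subalgebra A) :
  free_on E x -> S x -> forall a, S a.
Proof.
move=> xfree Sx a; have [EA /(_ _ (variety_subalg EA))] := xfree.
move=> /(_ S (to_subalg Sx))[f [fh fx _]].
have vfh := hom_comp fh (@subalg_val_hom _ _ _ _ S).
have vfx : (val \o f) x = x by rewrite /= fx to_subalgK.
by rewrite -[a](free_hom_id xfree vfh vfx); apply: subalgP.
Qed.

Fact fun_mop_multilinear A (a : {ffun 'I_m -> (nat -> A)}) i (c : k) b b' :
  let op (a : {ffun 'I_m -> (nat -> A)}) t := mop [ffun i => a i t] in
  op (upd a i (c *: b + b')) = c *: op (upd a i b) + op (upd a i b').
Proof.
move=> op; apply/funext => t; rewrite /op.
rewrite !(map_upd (fun g => g t)) mop_multilinear.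
by rewrite -!(map_upd (fun g : nat -> A => g t)).
Qed.

Fact fun_mop_one A (hu : u) (i : 'I_m) (a : nat -> A) :
  let op (a : {ffun 'I_m -> (nat -> A)}) t := mop [ffun i => a i t] in
  op (upd [ffun=> fun=> mone A hu] i a) = a.
Proof.
move=> op; apply/funext => t; rewrite /op (map_upd (fun g => g t)).
rewrite (_ : [ffun _ => _] = [ffun=> mone A hu]); first exact: mop_one.
by apply/ffunP => j; rewrite !ffunE.
Qed.

(** The parameter [t] ranges over [nat] only: in characteristic 0 these values already determine the
    coefficients of a polynomial function. *)
Definition fun_malg A : malg k m u :=
  MAlg (@fun_mop_multilinear A) (@fun_mop_one A).

Lemma fun_eval_hom A t : malg_hom ((fun g => g t) : fun_malg A -> A).
Proof. by []. Qed.

Lemma variety_fun (E : set (mterm k m u)) A :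
  variety E A -> variety E (fun_malg A).
Proof.
move=> EA f Ef v; apply/funext => t.
by have := hom_teval v f (fun_eval_hom A t); rewrite EA.
Qed.

End Homomorphisms.

(** * Vanishing polynomial functions with vector coefficients *)

Lemma poly_fun_eq0 (k : fieldType) (V : lmodType k) (n : nat) (c : nat -> V) :
  [pchar k] =i pred0 ->
  (forall t : nat, \sum_(i < n) t%:R ^+ i *: c i = 0) ->
  forall i, (i < n)%N -> c i = 0.
Proof.
move=> /pcharf0P k0; elim: n c => // n IHn c c0.
(* comparing the values at 2t and t eliminates the leading coefficient *)
have cn i : (i < n)%N -> c i = 0.
  move=> ltin; have ne0 : 2%:R ^+ i - 2%:R ^+ n != 0 :> k.
    rewrite subr_eq0 -subr_eq0 -opprB oppr_eq0 -!natrX -natrB; last first.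
      by rewrite leq_exp2l // ltnW.
    by rewrite k0 subn_eq0 leq_exp2l // -ltnNge.
  suff H t : \sum_(i < n) t%:R ^+ i *: ((2%:R ^+ i - 2%:R ^+ n) *: c i) = 0.
    have /eqP := IHn (fun i => (2%:R ^+ i - 2%:R ^+ n) *: c i) H i ltin.
    by rewrite scaler_eq0 (negPf ne0) => /eqP.
  have := congr2 (fun v w => v - 2%:R ^+ n *: w) (c0 (2 * t)%N) (c0 t).
  rewrite scaler0 subr0; apply: etrans.
  rewrite !big_ord_recr /= scalerDr scaler_sumr scalerA natrM exprMn opprD.
  rewrite addrACA subrr addr0 -sumrB; apply: eq_bigr => j _.
  by rewrite exprMn !scalerA -scalerBl mulrBr mulrC [_ * 2%:R ^+ n]mulrC.
move=> i; rewrite ltnS leq_eqVlt => /orP[/eqP ->|/cn //].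
(* The lower coefficients being zero, the value at 1 is the leading coefficient. *)
have := c0 1%N; rewrite big_ord_recr /= expr1n scale1r big1 ?add0r // => j _.
by rewrite cn // scaler0.
Qed.

(** * First-order expansions of polynomial functions *)

Section Jets.
Variables (k : fieldType) (hk : [pchar k] =i pred0).
Variables (m : nat) (u : bool) (A : malg k m u).
Implicit Types (g h : nat -> A) (p q : A).

(* [jet g p q] : g is a polynomial function with g t = p + t q + O(t^2) *)
Inductive jet : (nat -> A) -> A -> A -> Prop :=
| jet_const p : jet (fun=> p) p 0
| jet_lin c g h p p' q q' : jet g p q -> jet h p' q' ->
    jet (c *: g + h) (c *: p + p') (c *: q + q')
| jet_shift g p q : jet g p q -> jet (fun t => t%:R *: g t) 0 p.

(** The length [N.+2] keeps the coefficients of degree 0 and 1 inside the sum, and leaving [N] free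
    lets two expansions be padded to a common length. *)
Lemma jet_poly g p q : jet g p q ->
  exists n (c : nat -> A), [/\ c 0%N = p, c 1%N = q & forall N t, (n <= N)%N ->
    g t = \sum_(i < N.+2) t%:R ^+ i *: c i].
Proof.
elim=> [{}p|c {}g h {}p p' {}q q' _ [n [a [<- <- ga]]] _ [n' [b [<- <- hb]]]|
  {}g {}p {}q _ [n [a [<- _ ga]]]].
- exists 0%N, (fun i => if i is 0%N then p else 0); split=> // N t _.
  by rewrite big_ord_recl big1 ?addr0 ?scale1r // => i _; rewrite scaler0.
- exists (maxn n n'), (fun i => c *: a i + b i); split=> // N t.
  rewrite geq_max => /andP[nN n'N]; rewrite [LHS]/= {1}/GRing.add /=.
  rewrite {1}/GRing.scale /= (ga N) // (hb N) // scaler_sumr -big_split; apply: eq_bigr => i _ /=.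
  by rewrite scalerDr !scalerA mulrC.
- exists n.+1, (fun i => if i is j.+1 then a j else 0); split=> // -[//|N] t nN.
  rewrite big_ord_recl scaler0 add0r (ga N) // scaler_sumr.
  by apply: eq_bigr => i _; rewrite scalerA -exprS.
Qed.

Lemma jet_at0 g p q : jet g p q -> g 0%N = p.
Proof.
move=> /jet_poly[n [c [<- _ gE]]]; rewrite (gE n) //.
rewrite big_ord_recl scale1r big1 ?addr0 // => i _.
by rewrite expr0n scale0r.
Qed.

(** The difference of the two jets is a jet of the zero function, with linear coefficient
    [q' - q]. *)
Lemma jet_inj g p q p' q' : jet g p q -> jet g p' q' -> q = q'.
Proof.
move=> gpq gpq'; have := jet_lin (-1) gpq gpq'.
rewrite scaleN1r addNr => /jet_poly[n [c [_ c1 c0]]].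
apply/eqP; rewrite eq_sym -subr_eq0 addrC -scaleN1r -c1; apply/eqP.
by apply: (@poly_fun_eq0 _ _ n.+2) => // t; rewrite -(c0 n).
Qed.

Local Notation fmop := (@mop _ _ _ (fun_malg A)).

(** Induction on a set [s] of slots outside which the functions are constant. In a slot [j] of [s],
    induction on the jet reduces by multilinearity to a constant, which removes [j] from [s], or to
    a factor [t], which comes out of the operation. *)
Lemma jet_mop (g : {ffun 'I_m -> (nat -> A)}) (p q : {ffun 'I_m -> A}) :
  (forall i, jet (g i) (p i) (q i)) ->
  jet (fmop g) (mop p) (\sum_i mop (upd p i (q i))).
Proof.
pose goal (g : {ffun 'I_m -> (nat -> A)}) (p q : {ffun 'I_m -> A}) :=
  jet (fmop g) (mop p) (\sum_i mop (upd p i (q i))).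
suff H (s : {set 'I_m}) (g' : {ffun 'I_m -> (nat -> A)})
    (p' q' : {ffun 'I_m -> A}) : (forall i, jet (g' i) (p' i) (q' i)) ->
    (forall i, i \notin s -> g' i = (fun=> p' i) /\ q' i = 0) -> goal g' p' q'.
  by move=> gpq; apply: (H [set: 'I_m]%SET) => // i; rewrite inE.
have [n] := ubnP #|s|; elim: n s g' p' q' => // n IHn s g' p' q' sn gpq gs.
have [s0|[j js]] := set_0Vmem s.
  have g'E i : g' i = (fun=> p' i) /\ q' i = 0 by apply: gs; rewrite s0 inE.
  rewrite /goal big1 => [|i _]; last by rewrite (g'E i).2 mop_upd0.
  rewrite (_ : fmop g' = (fun=> mop p')); first exact: jet_const.
  apply/funext => t /=; congr mop; apply/ffunP => i.
  by rewrite ffunE (g'E i).1.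
suff Hj h r w : jet h r w -> goal (upd g' j h) (upd p' j r) (upd q' j w).
  by have := Hj _ _ _ (gpq j); rewrite !upd_id.
elim=> {h r w} [r|c h h' r r' w w' _ IH _ IH'|h r w _ IH].
- apply: (IHn (s :\ j)%SET).
  + by move: sn; rewrite (cardsD1 j) js.
  + move=> i; rewrite !ffunE; case: eqP => // _; exact: jet_const.
  + move=> i; rewrite !inE negb_and negbK !ffunE.
    by case: eqP => //= _ /gs.
- rewrite /goal !mop_multilinear.
  rewrite (_ : \sum_i _ = c *: \sum_i mop (upd (upd p' j r) i (upd q' j w i)) +
    \sum_i mop (upd (upd p' j r') i (upd q' j w' i))); first exact: jet_lin.
  rewrite scaler_sumr -big_split; apply: eq_bigr => i _ /=.
  have [->|ij] := eqVneq i j; first by rewrite !upd_eq !upd_upd mop_multilinear.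
  by rewrite !upd_neq // ![upd (upd _ j _) i _]updC 1?eq_sym // mop_multilinear.
(* The constant term in slot [j] is 0, so only the summand that replaces slot [j] survives. *)
- rewrite /goal mop_upd0 (bigD1 j) //= upd_eq upd_upd big1 => [|i ij]; last first.
    by rewrite updC 1?eq_sym // mop_upd0.
  rewrite addr0; have := jet_shift IH; congr jet; apply/funext => t /=.
  by rewrite !(map_upd (fun g => g t)) mop_updZ.
Qed.

End Jets.

(** * Existence and uniqueness of derivations of the free algebra *)

Section Derivations.
Variables (k : fieldType) (hk : [pchar k] =i pred0) (m : nat) (hm : (2 <= m)%N).
Variables (u : bool) (E : set (mterm k m u)) (A : malg k m u) (x : A).
Hypothesis xfree : free_on E x.

Lemma der_lin (d : der A) (c : k) (a b : A) : d (c *: a + b) = c *: d a + d b.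
Proof. exact: (derP d).1. Qed.

Lemma der_mop (d : der A) (a : {ffun 'I_m -> A}) :
  d (mop a) = \sum_(i < m) mop (upd a i (d (a i))).
Proof. exact: (derP d).2. Qed.

Lemma der_fun0 (d : der A) : d 0 = 0.
Proof. exact: lin_fun0 (der_lin d). Qed.

(** The Leibniz rule for the product of [m] identities gives [d 1 = m d 1], and [m - 1] is
    invertible in [k]. *)
Lemma der_one (d : der A) (hu : u) : d (mone A hu) = 0.
Proof.
have := der_mop d [ffun=> mone A hu].
have i0 : 'I_m := Ordinal (ltnW hm).
rewrite -{1}(upd_id [ffun=> mone A hu] i0) ffunE mop_one.
under eq_bigr => i _ do rewrite ffunE mop_one.
rewrite sumr_const card_ord => d1E.
have : d (mone A hu) *+ m.-1 = 0.
  apply: (addrI (d (mone A hu))).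
  by rewrite addr0 -mulrS prednK ?(ltnW hm) // -d1E.
rewrite -scaler_nat => /eqP; rewrite scaler_eq0 (pcharf0P k).1 //.
by rewrite -subn1 subn_eq0 leqNgt hm => /eqP.
Qed.

Lemma der_inj (d e : der A) : d x = e x -> d = e.
Proof.
move=> dex; apply: der_ext; apply: (@free_ind _ _ _ E A x
  (@Subalgebra _ _ _ A (fun a => d a = e a) _ _ _ _)) => //.
- by rewrite !der_fun0.
- by move=> c a b da db; rewrite !der_lin da db.
- by move=> a da; rewrite !der_mop; apply: eq_bigr => i _; rewrite da.
- by move=> h; rewrite !der_one.
Qed.

Lemma der_exists (a : A) : exists d : der A, d x = a.
Proof.
have [EA _] := xfree.
have [_ /(_ _ (variety_fun EA) (fun t => x + t%:R *: a))[f [fh fx _]]] := xfree.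
have xjet : jet (f x) x a.
  have := jet_lin 1 (jet_shift (jet_const a)) (jet_const x).
  rewrite !scale1r add0r addr0 fx; congr jet; apply/funext => t.
  exact: addrC.
(* The elements whose image under [f] has a first-order expansion form a subalgebra containing
   [x]. *)
have fjet y : exists pq : A * A, jet (f y) pq.1 pq.2.
  apply: (@free_ind _ _ _ E A x (@Subalgebra _ _ _ A
    (fun y => exists pq : A * A, jet (f y) pq.1 pq.2) _ _ _ _)) => //=.
  - by exists (0, 0); rewrite (hom0 fh); apply: jet_const.
  - case: fh => fl _ _ c b b' [pq bj] [pq' bj'].
    by exists (c *: pq.1 + pq'.1, c *: pq.2 + pq'.2); rewrite fl; apply: jet_lin.
  - case: fh => _ fm _ b /choice[pq bj].
    exists (mop [ffun i => (pq i).1],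
      \sum_i mop (upd [ffun i => (pq i).1] i ([ffun i => (pq i).2] i))).
    by rewrite fm; apply: jet_mop => i; rewrite !ffunE.
  - by case: fh => _ _ f1 hu; exists (mone A hu, 0); rewrite f1; apply: jet_const.
  - by exists (x, a).
have [pq pqP] := choice fjet.
(* Evaluation at [t = 0] after [f] is an endomorphism fixing [x], so the constant term of [f y] is
   [y]. *)
have pqE y : (pq y).1 = y.
  rewrite -(jet_at0 (pqP y)).
  apply: (free_hom_id xfree (hom_comp fh (fun_eval_hom A 0%N))).
  by rewrite /= fx scale0r addr0.
pose d y := (pq y).2; have dP y : jet (f y) y (d y) by rewrite -{2}[y]pqE.
(* Both rules compare two expansions of one function, using that linear coefficients are unique. *)
have dder : is_derivation d.
  case: fh => fl fm _; split=> [c b b'|b]; apply: (jet_inj hk (dP _)).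
    by rewrite fl; apply: jet_lin.
  rewrite fm; have := @jet_mop _ _ _ _ [ffun i => f (b i)] b [ffun i => d (b i)].
  under eq_bigr do rewrite ffunE.
  by apply=> i; rewrite !ffunE.
by exists (Der dder) => /=; apply: jet_inj (dP x) xjet.
Qed.

Lemma partialE (a : A) : partial x a x = a.
Proof. by have := xgetPex 0 (der_exists a). Qed.

Lemma der_mulE (d e : der A) : der_mul x d e x = d (e x).
Proof. exact: partialE. Qed.

End Derivations.

(** * Exchanging and rescaling the arguments of the operation *)

Section Symmetric.
Variables (k : fieldType) (m : nat) (u : bool) (A : malg k m u).

Lemma mop_upd_sym (a : {ffun 'I_m -> A}) (i j : 'I_m) :
  symmetric_malg A -> mop (upd (upd a j (a i)) i (a j)) = mop a.
Proof.
move=> /(_ a (tperm i j)) <-; congr mop; apply/ffunP => l; rewrite !ffunE.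
case: tpermP => [->|->|/eqP/negPf-> /eqP/negPf->//]; rewrite ?eqxx //.
by case: eqP => // ->.
Qed.

Lemma mop_scale (c : 'I_m -> k) (b : 'I_m -> A) :
  mop [ffun i => c i *: b i] = (\prod_i c i) *: mop [ffun i => b i].
Proof.
(* Generalized to scalars present only in the slots listed in [r], for induction on [r]. *)
suff H (r : seq 'I_m) : uniq r ->
    mop [ffun i => if i \in r then c i *: b i else b i] =
      (\prod_(i <- r) c i) *: mop [ffun i => b i].
  rewrite -big_enum /= -H ?enum_uniq //; congr mop; apply/ffunP => i.
  by rewrite !ffunE mem_enum.
elim: r => [_|j r IHr /=/andP[jr ur]]; first by rewrite big_nil scale1r.
rewrite big_cons -scalerA -IHr // -[X in _ = _ *: mop X](upd_id _ j).
rewrite -mop_updZ; congr mop; apply/ffunP => i; rewrite !ffunE inE.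
by have [->|] := eqVneq i j; rewrite ?(negPf jr).
Qed.

End Symmetric.

(** * The positive part as a graded subalgebra *)

Section PositivePart.
Variables (k : fieldType) (hk : [pchar k] =i pred0) (m : nat) (hm : (2 <= m)%N).
Variables (u : bool) (E : set (mterm k m u)) (A : malg k m u) (x : A).
Hypothesis xfree : free_on E x.

Let partialE := partialE hk xfree.
Let der_inj := der_inj hk hm xfree.

Lemma partial_lin (c : k) (a b : A) :
  partial x (c *: a + b) = c *: partial x a + partial x b.
Proof. by apply: der_inj; rewrite /= !partialE. Qed.

Lemma der_sumE (I : finType) (e : I -> der A) (a : A) :
  (\sum_i e i) a = \sum_i e i a.
Proof. by apply: (big_morph (fun d : der A => d a)). Qed.

Lemma der_sum (d : der A) (n : nat) (a : 'I_n -> A) :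
  d (\sum_i a i) = \sum_i d (a i).
Proof.
apply: big_morph => [b c|]; last exact: der_fun0.
by rewrite -[b]scale1r der_lin !scale1r.
Qed.

Lemma homog_sum (n : nat) (I : finType) (F : I -> A) :
  (forall i, homog x n (F i)) -> homog x n (\sum_i F i).
Proof.
move=> Fh; apply: big_ind => [|a b ah bh|i _]; [exact: homog_zero| |exact: Fh].
by rewrite -[a]scale1r; apply: homog_lin.
Qed.

(** Each Leibniz summand raises the degree of exactly one slot by [r]; the identity, of degree 0, is
    sent to 0. *)
Lemma der_homogE (d : der A) (r n : nat) (a : A) :
  homog x r.+1 (d x) -> homog x n a -> homog x (n + r) (d a).
Proof.
move=> dh; elim=> {n a} [h||n a ah IH|n|n c a b _ IHa _ IHb].
- by rewrite (der_one hk hm); apply: homog_zero.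
- exact: dh.
- rewrite der_mop; apply: homog_sum => i.
  rewrite (_ : (_ + r)%N = \sum_j (if j == i then n j + r else n j))%N.
    by apply: homog_op => j; rewrite ffunE; case: eqP => [->|_].
  rewrite (bigD1 i) //= [RHS](bigD1 i) //= eqxx addnAC; congr addn.
  by apply: eq_bigr => j /negPf ->.
- by rewrite der_fun0; apply: homog_zero.
- by rewrite der_lin; apply: homog_lin.
Qed.

(* the bound on N allows sums of different lengths to be added termwise *)
Definition pos_elt (a : A) : Prop := exists n (c : nat -> A),
  (forall i, homog x i.+2 (c i)) /\
  forall N, (n <= N)%N -> a = \sum_(i < N) c i.

Lemma pos_elt_homog n a : homog x n.+2 a -> pos_elt a.
Proof.
move=> ah; exists n.+1, (fun i => if i == n then a else 0); split=> [i|N nN].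
  by case: eqP => [->//|_]; apply: homog_zero.
by rewrite -big_mkcond (big_pred1 (Ordinal nN)).
Qed.

Lemma pos_elt0 : pos_elt 0.
Proof. exact: pos_elt_homog (homog_zero x 2). Qed.

Lemma pos_elt_lin (c : k) a b : pos_elt a -> pos_elt b -> pos_elt (c *: a + b).
Proof.
move=> [n [a' [ah aE]]] [n' [b' [bh bE]]].
exists (maxn n n'), (fun i => c *: a' i + b' i); split=> [i|N].
  exact: homog_lin.
rewrite geq_max => /andP[/aE -> /bE ->].
by rewrite scaler_sumr -big_split.
Qed.

Lemma pos_elt_sum (I : finType) (F : I -> A) :
  (forall i, pos_elt (F i)) -> pos_elt (\sum_i F i).
Proof.
move=> Fp; apply: big_ind => [|a b ap bp|i _]; [exact: pos_elt0| |exact: Fp].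
by rewrite -[a]scale1r; apply: pos_elt_lin.
Qed.

(** Evaluation at [x] sends the component of index [i.+1] to degree [i.+2], so closure properties
    can be checked on elements of [A]. *)
Lemma der_posP (d : der A) : der_pos x d <-> pos_elt (d x).
Proof.
split=> [[n [e [eh ->]]]|[n [c [ch dE]]]].
  rewrite der_sumE; apply: pos_elt_sum => i; have [a ah <-] := eh i.
  by rewrite partialE; apply: pos_elt_homog ah.
exists n, (fun i => partial x (c i)); split=> [i|]; first by exists (c i).
apply: der_inj; rewrite (dE n) // der_sumE.
by apply: eq_bigr => i _; rewrite partialE.
Qed.

Lemma der_pos_subalgebra : der_subalgebra x (der_pos x).
Proof.
split=> [|c d e|d e].
- exact/der_posP/pos_elt0.
- by move=> /der_posP dp /der_posP ep; apply/der_posP/pos_elt_lin.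
move=> [n [d' [dh ->]]] /der_posP[n' [b [bh /(_ _ (leqnn n')) eE]]].
apply/der_posP; rewrite (der_mulE hk xfree) eE der_sum.
apply: pos_elt_sum => j; rewrite der_sumE; apply: pos_elt_sum => i.
(* A derivation of degree [i.+1] applied to an element of degree [j.+2] gives degree
   [(j + i.+1).+2]. *)
have [a ah <-] := dh i; apply: (@pos_elt_homog (j + i.+1)).
by rewrite -!addSn; apply: der_homogE => //; rewrite partialE.
Qed.

Lemma homog_power : homog x m (mop [ffun=> x]).
Proof.
have := @homog_op _ _ _ _ x (fun=> 1%N) [ffun=> x].
rewrite sum1_card card_ord; apply=> i; rewrite ffunE; exact: homog_var.
Qed.

(** * Subalgebras containing the power of [x] *)

Section Generated.
Hypotheses (hu : u -> m = 2%N) (hsym : symmetric_malg A).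
Variable S : set (der A).
Hypothesis Ssub : der_subalgebra x S.
Hypothesis S_power : S (partial x (mop [ffun=> x])).

Let G (a : A) : Prop := S (partial x a).

Let G0 : G 0.
Proof.
case: Ssub => S0 _ _; rewrite /G (_ : partial x 0 = 0) //.
by apply: der_inj; rewrite partialE.
Qed.

Let G_lin (c : k) a b : G a -> G b -> G (c *: a + b).
Proof. by case: Ssub => _ Slin _ Ga Gb; rewrite /G partial_lin; apply: Slin. Qed.

Let G_scale (c : k) a : G a -> G (c *: a).
Proof. by move=> Ga; rewrite -[c *: a]addr0; apply: G_lin. Qed.

Let G_der a b : G a -> G b -> G (partial x a b).
Proof.
case: Ssub => _ _ Smul Ga Gb.
by have := Smul _ _ Ga Gb; rewrite /der_mul partialE.
Qed.

Lemma generated_mop_set (s : {set 'I_m}) (a : {ffun 'I_m -> A}) :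
  (forall i, i \in s -> G (a i)) -> (forall i, i \notin s -> a i = x) ->
  G (mop a).
Proof.
have [n] := ubnP #|s|; elim: n s a => // n IHn s a sn Ga ax.
have [s0|[j js]] := set_0Vmem s.
  rewrite (_ : a = [ffun=> x]) //; apply/ffunP => i.
  by rewrite ffunE ax // s0 inE.
pose s' := (s :\ j)%SET; pose a' := upd a j x; pose d := partial x (a j).
have s'n : (#|s'| < n)%N by move: sn; rewrite (cardsD1 j) js.
have a's i : i \in s' -> a' i = a i.
  by rewrite !inE => /andP[ij _]; rewrite upd_neq.
have a'x i : i \notin s' -> a' i = x.
  by rewrite !inE negb_and negbK !ffunE; case: eqP => //= _ /ax.
have Ga' i : i \in s' -> G (a' i).
  by move=> /[dup] /a's ->; rewrite !inE => /andP[_ /Ga].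
(* by symmetry, replacing any of the remaining x's by [a j] gives [mop a] *)
have dx i : i \notin s' -> mop (upd a' i (d (a' i))) = mop a.
  move=> is'; rewrite a'x // partialE.
  have [->|ij] := eqVneq i j; first by rewrite upd_upd upd_id.
  rewrite -(mop_upd_sym a i j hsym) /a' -(ax i) //.
  by move: is'; rewrite !inE ij.
have : G (d (mop a')) by apply: G_der; [exact: Ga|exact: (IHn s')].
rewrite der_mop (bigID (mem s')) /= addrC (eq_bigr (fun=> mop a)) //.
rewrite sumr_const -scaler_nat; set c := _%:R; set v := \sum_(_ | _) _.
(* [c] counts the slots outside [s'], among which is [j]. *)
have c0 : c != 0.
  rewrite /c (pcharf0P k).1 // -lt0n; apply/card_gt0P; exists j.
  by rewrite unfold_in /= !inE eqxx.
(* Replacing the entry of a slot in [s'] by its image under [d] keeps it in [G], so the induction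
   hypothesis for [s'] applies to each summand. *)
have Gv : G v.
  apply: big_ind => [//|b b' Gb Gb'|i is'].
    by rewrite -[b]scale1r; apply: G_lin.
  apply: (IHn s') => // l ls'; rewrite ffunE; case: eqP => li.
  - by apply: G_der; [exact: Ga|exact: Ga'].
  - exact: Ga'.
  - by move: ls'; rewrite li is'.
  - exact: a'x.
move=> Gcv; rewrite -[mop a]scale1r -(mulVf c0) -scalerA; apply: G_scale.
by rewrite -[c *: _](addrK v) addrC -scaleN1r; apply: G_lin.
Qed.

Lemma generated_mop (a : {ffun 'I_m -> A}) :
  (forall i, G (a i) \/ exists c, a i = c *: x) -> G (mop a).
Proof.
move=> aP; have /choice[cb cbP] i : exists cb : k * A,
    a i = cb.1 *: cb.2 /\ (G cb.2 \/ cb.2 = x).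
  have [Gai|[c ->]] := aP i; last by exists (c, x); split=> //; right.
  by exists (1, a i); rewrite scale1r; split=> //; left.
rewrite (_ : a = [ffun i => (cb i).1 *: (cb i).2]); last first.
  by apply/ffunP => i; rewrite ffunE (cbP i).1.
rewrite mop_scale; apply: G_scale.
apply: (@generated_mop_set [set i | `[< G (cb i).2 >]]%SET) => i.
  by rewrite inE ffunE => /asboolP.
by rewrite inE ffunE => /asboolP; case: (cbP i).2.
Qed.

(** The claim for degree at least 2, extended to all degrees so that induction on [homog] goes
    through. Without an identity in the signature, degree 0 contains only zero, hence the separate
    alternative. *)
Let Q (n : nat) (a : A) : Prop :=
  match n with
  | 0 => a = 0 \/ exists (h : u) (c : k), a = c *: mone A h
  | 1 => exists c, a = c *: x
  | _ => G a
  end.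

Lemma generated_homog n a : homog x n a -> Q n a.
Proof.
have Q0 l : Q l 0.
  by case: l => [|[|l]]; [left|exists 0; rewrite scale0r|exact: G0].
have Q_lin l (c : k) b b' : Q l b -> Q l b' -> Q l (c *: b + b').
  case: l => [|[|l]] /=; last exact: G_lin.
    case=> [->|[h [d ->]]] []; rewrite ?scaler0 ?add0r; [by left| | |].
    + by case=> h [d ->]; right; exists h, d.
    + by move->; right; exists h, (c * d); rewrite addr0 scalerA.
    + case=> h' [d' ->]; right; exists h, (c * d + d').
      by rewrite (bool_irrelevance h' h) scalerDl scalerA.
  by case=> d -> [d' ->]; exists (c * d + d'); rewrite scalerDl scalerA.
elim=> {n a} [h||n a _ IH|n|n c a b _ + _]; [| | |exact: Q0|exact: Q_lin].
- by right; exists h, 1; rewrite scale1r.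
- by exists 1; rewrite scale1r.
(* A slot of degree 0 holds zero or a multiple of the identity. In the second case [m = 2], and the
   product is a multiple of the other factor, whose degree is the total degree. *)
have [/existsP[i /eqP ni0]|] := boolP [exists i, n i == 0%N].
  have := IH i; rewrite ni0 => -[ai0|[h [c aiE]]].
    by rewrite -(upd_id a i) ai0 mop_upd0; apply: Q0.
  have [j ji] : exists j, j != i.
    apply/existsP; rewrite -negb_forall; apply/negP => /forallP all_i.
    have := hm; rewrite ltnNge -[m]card_ord => /negP; apply.
    by apply/card_le1_eqP => l l' _ _; rewrite (eqP (all_i l)) (eqP (all_i l')).
  have ijP l : l != i -> l = j.
    move=> li; apply/eqP/negPn/negP => lj.
    have card3 : #|[set i; j; l]%SET| = 3%N.
      rewrite finset.setUC cardsU1 cards2 !inE negb_or li lj.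
      by rewrite eq_sym ji.
    by have := max_card [set i; j; l]%SET; rewrite card3 card_ord (hu h).
  rewrite (bigD1 i) //= ni0 add0n (big_pred1 j) => [|l]; last first.
    by apply/idP/eqP => [/ijP|->].
  rewrite -(upd_id a i) aiE mop_updZ.
  rewrite (_ : upd a i _ = upd [ffun=> mone A h] j (a j)) ?mop_one.
    by rewrite -[c *: _]addr0; apply: Q_lin.
  apply/ffunP => l; rewrite !ffunE; have [->|/ijP ->] := eqVneq l i.
    by rewrite eq_sym (negPf ji).
  by rewrite eqxx.
rewrite negb_exists => /forallP n0.
(* All [m] slots have positive degree and [m] is at least 2, so [Q] at the total degree is [G]. *)
have : (1 < \sum_i n i)%N.
  rewrite (leq_trans hm) // -{1}[m]card_ord -sum1_card leq_sum // => i _.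
  by rewrite lt0n.
have : G (mop a).
  apply: generated_mop => i; have := IH i; move: (n0 i).
  by case: (n i) => [|[|l]] //= _; [right|left].
by case: (\sum_i n i)%N => [|[|l]].
Qed.

Lemma der_pos_generated : der_pos x `<=` S.
Proof.
move=> _ [n [e [eh ->]]]; case: Ssub => S0 Slin _.
apply: big_ind => [//|d d' Sd Sd'|i _]; first by rewrite -[d]scale1r; apply: Slin.
by have [a /generated_homog Ga <-] := eh i.
Qed.

End Generated.

End PositivePart.

Theorem proposition3 (k : fieldType) (hk : [pchar k] =i pred0)
    (m : nat) (hm : (2 <= m)%N) (u : bool) (hu : u -> m = 2%N)
    (E : set (mterm k m u)) (hE : nontrivial_variety E)
    (hsym : forall B : malg k m u, variety E B -> symmetric_malg B)
    (A : malg k m u) (x : A) (hA : free_on E x) :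
  der_pos x =
    smallest (der_subalgebra x) [set partial x (mop [ffun _ : 'I_m => x])].
Proof.
apply/seteqP; split=> [d dpos S [Ssub SD]|].
  have Asym : symmetric_malg A by apply: hsym; case: hA.
  exact: (der_pos_generated hk hm hA hu Asym Ssub (SD _ erefl)).
apply: smallest_sub; first exact: (der_pos_subalgebra hk hm hA).
move=> _ ->; apply/(der_posP hk hm hA); rewrite (partialE hk hA).
(* The power of [x] has degree [m = (m - 2) + 2], the form that [pos_elt_homog] expects. *)
have := homog_power x; rewrite -{2}(subnK hm) addn2; exact: pos_elt_homog.
Qed.
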